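(* Let $R$ be an indecomposable commutative ring, $P$ a set, and $\Pi=\prod_{x\in P}Re_x$. (a) $\operatorname{LAut}(\Pi)=\operatorname{Aut}(\Pi)$ if and only if $|P|<\mu_R$. (b) If $|P|\ge\mu_R$, then there exists a unital $R$-linear map $\eta:\Pi\to\Pi$ such that $\eta$ is an $n$-local automorphism of $\Pi$ for all positive integers $n$, but $\eta$ is not surjective. In particular, $\eta\notin\operatorname{Aut}(\Pi)$.
   Context: A commutative ring $R$ with identity is indecomposable if $0\ne1$ and $0,1$ are its only idempotents. $\Pi=\prod_{x\in P}Re_x$ is the full cartesian product of $|P|$ copies of $R$, an $R$-algebra with componentwise operations; its elements are written $a=\sum_{x\in P}a_xe_x$ with arbitrary $a_x\in R$. ''Unital'' means $\eta(1)=1$. $\operatorname{Aut}(A)$ is the group of $R$-algebra automorphisms of an $R$-algebra $A$. For a positive integer $n$, an $n$-local automorphism of $A$ is an $R$-linear map $\eta:A\to A$ such that for all $a_1,\dots,a_n\in A$ there is $\varphi\in\operatorname{Aut}(A)$ with $\eta(a_i)=\varphi(a_i)$ for all $1\le i\le n$. Local automorphism means $1$-local automorphism; $\operatorname{LAut}(A)$ is the set of all local automorphisms. Cardinal $\mu_R$: if $R$ is finite, $\mu_R=\aleph_0$. If $R$ is infinite, $\mu_R$ is the least cardinal $\kappa$ such that a set of cardinality $\kappa$ carries a nontrivial $|R|^+$-additive measure $\mu$ with values in $\{0,1\}$ defined on all subsets (nontrivial: the whole set has measure $1$ and every singleton has measure $0$; $|R|^+$-additive: $\mu(\bigcup_{i\in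 I}X_i)=\sum_{i\in I}\mu(X_i)$ for pairwise disjoint families with $|I|\le|R|$); equivalently, such that it carries a non-principal $|R|^+$-complete ultrafilter. If no such cardinal exists, $\mu_R=\infty$; then $|P|<\mu_R$ holds for every set $P$ and statements about $|P|\ge\mu_R$ are void. *)

(* Defs.v *)
From HB Require Import structures.
From mathcomp Require Import all_boot all_order all_algebra.
From mathcomp Require Import all_classical.

Set Implicit Arguments.
Unset Strict Implicit.
Unset Printing Implicit Defensive.

Import GRing.Theory.
Local Open Scope classical_set_scope.
Local Open Scope card_scope.
Local Open Scope ring_scope.

Definition indecomposable (R : comPzRingType) : Prop :=
  (0 : R) <> 1 /\ forall e : R, e * e = e -> e = 0 \/ e = 1.

(* The element sum_x a_x e_x is the function x |-> a_x.  R^o is R as a module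
   over itself, so that functions P -> R^o form both a ring and an R-module,
   pointwise.  The library's algType R requires 1 != 0, which fails for this
   algebra when P is empty; algebra morphisms are therefore spelled out as
   linear multiplicative maps below. *)
Definition fullprod (R : comPzRingType) (P : Type) : Type := P -> R^o.

HB.instance Definition _ (R : comPzRingType) (P : Type) :=
  GRing.ComPzRing.copy (fullprod R P) (P -> R^o).
HB.instance Definition _ (R : comPzRingType) (P : Type) :=
  GRing.Lmodule.copy (fullprod R P) (P -> R^o).

Definition Aut (R : comPzRingType) (P : Type) :
    set (fullprod R P -> fullprod R P) :=
  [set phi : fullprod R P -> fullprod R P | [/\ linear phi, monoid_morphism phi & bijective phi]].

Definition nLAut (n : nat) (R : comPzRingType) (P : Type) :
    set (fullprod R P -> fullprod R P) :=
  [set eta : fullprod R P -> fullprod R P | linear eta /\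
    forall a : 'I_n -> fullprod R P,
      exists2 phi, Aut phi & forall i, eta (a i) = phi (a i)].

Definition LAut (R : comPzRingType) (P : Type) := @nLAut 1 R P.

(* The families considered are those indexed by sets of cardinality at most
   that of R.  A sum of natural numbers exists exactly when all but finitely
   many terms vanish; this is required explicitly because the big operator
   returns 0 on infinite supports. *)
Definition succ_card_additive (R K : Type) (mu : set K -> nat) : Prop :=
  forall (I : choiceType) (F : I -> set K),
    [set: I] #<= [set: R] -> trivIset [set: I] F ->
    finite_set [set i | mu (F i) <> 0%N] /\
    mu (\bigcup_i F i) = \big[addn/0%N]_(i \in [set: I]) mu (F i).

Definition nontrivial_01_measure (R K : Type) (mu : set K -> nat) : Prop :=
  [/\ forall X, mu X = 0%N \/ mu X = 1%N,
      mu [set: K] = 1%N,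
      forall x, mu [set x] = 0%N
    & succ_card_additive R mu].

Definition carries_measure (R K : Type) : Prop :=
  exists mu : set K -> nat, nontrivial_01_measure R mu.

(* The cardinal mu_R, when it exists, is the cardinality of any K such that
   is_mu R K. *)
Definition is_mu (R K : Type) : Prop :=
  (finite_set [set: R] -> [set: K] #= [set: nat]) /\
  (infinite_set [set: R] ->
     carries_measure R K /\
     forall L : Type, carries_measure R L -> [set: K] #<= [set: L]).

Definition card_lt (S T : Type) : Prop :=
  [set: S] #<= [set: T] /\ ~ ([set: T] #<= [set: S]).

(* |P| < mu_R and |P| >= mu_R.  When no K satisfies is_mu R K, i.e. when mu_R
   is infinity, the former always holds and the latter never does. *)
Definition lt_mu (R P : Type) : Prop :=
  forall K : Type, is_mu R K -> card_lt P K.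

Definition ge_mu (R P : Type) : Prop :=
  exists2 K : Type, is_mu R K & [set: K] #<= [set: P].

(* Main.v *)
(* Automorphisms of R^P are exactly the reindexings a |-> a \o s by bijections
   s of P, because they permute the atoms of the algebra of idempotents.  Hence
   a local automorphism eta sends each a to some reindexing of a.  For x in P,
   let U_x be the family of all X with eta(1_X)(x) = 1.  It contains the set
   {a = eta(a)(x)} for every a : P -> R; when R is infinite this makes U_x an
   |R|^+-complete ultrafilter.  If P carries no nontrivial measure, U_x
   is generated by a point s x, so eta a = a \o s, and eta is an automorphism.
   Conversely, a non-principal |R|^+-complete ultrafilter U gives each a in R^P
   a limit along U.  A bijection of P with P + {point} turns the map extending
   a by its limit at the point into a non-surjective eta.  Given finitely many
   a_i, these are all equal to their limits on an infinite set Y, which has room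
   for one more point, so eta agrees with a reindexing on all of them. *)

Require Import Defs.
From mathcomp Require Import all_boot all_order all_algebra.
From mathcomp Require Import all_classical.

Set Implicit Arguments.
Unset Strict Implicit.
Unset Printing Implicit Defensive.

Import GRing.Theory.
Local Open Scope classical_set_scope.
Local Open Scope card_scope.
Local Open Scope ring_scope.

(** * Comparison of cardinals, and room for one more point *)

Lemma inj_surj_bij (S T : Type) (f : S -> T) :
  injective f -> (forall y, exists x, f x = y) -> bijective f.
Proof.
move=> fI /choice[g fg]; exists g => // x.
by apply: fI; rewrite fg.
Qed.

Lemma card_leTP (S T : Type) (B : set T) :
  [set: S] #<= B <-> exists2 f : S -> T, injective f & forall s, B (f s).
Proof.
split=> [/card_leP[f]|[f fI fB]].
  exists (fun s => val (f (SigSub (in_setT s)))) => [s t /val_inj e|s].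
    by have /(_ _ _ e)[] := @inj _ _ _ f _ _ (in_setT _) (in_setT _).
  by have := set_valP (f (SigSub (in_setT s))).
have [g] : $|{injfun [set: S] >-> B}|.
  by apply/injfunPex; exists f => // s t _ _ /fI.
exact: inj_card_le.
Qed.

(* By maximality, a largest set of pairwise everywhere different choice
   functions projects onto some A i, which then injects into every A j. *)
Lemma least_card (I : Type) (i0 : I) (A : I -> Type) :
  exists i, forall j, exists f : A i -> A j, injective f.
Proof.
pose D (S : set (forall i, A i)) :=
  forall s t, S s -> S t -> forall i, s i = t i -> s = t.
have [F FD Ftot|S [SD Smax]] := @Zorn_bigcup _ D.
  move=> s t [X FX Xs] [Y FY Yt] i.
  by have [/(_ _ Xs) Ys|/(_ _ Yt) Xt] := Ftot _ _ FX FY;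
    [exact: (FD Y)|exact: (FD X)].
have [i Si] : exists i, forall a : A i, exists2 s, S s & s i = a.
  apply: contrapT => /forallNP noi.
  have ex i : exists a : A i, forall s, S s -> s i <> a.
    have /existsNP[a Ha] := noi i.
    by exists a => s Ss sa; apply: Ha; exists s.
  pose f i := projT1 (cid (ex i)).
  have fS s i : S s -> s i <> f i by exact: (projT2 (cid (ex i))).
  apply: (Smax (f |` S)).
    split=> [s|/(_ f (or_introl erefl)) Sf]; first by right.
    exact: (fS _ i0 Sf).
  move=> s t [->|Ss] [->|St] i //; last exact: SD.
    by move=> e; case: (fS _ i St).
  by move=> e; case: (fS _ i Ss).
exists i => j.
have /choice[g gP] : forall a : A i, exists s, S s /\ s i = a.
  by move=> a; have [s] := Si a; exists s.
exists (fun a => g a j) => a b gab.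
have [Sa <-] := gP a; have [Sb <-] := gP b.
by rewrite (SD _ _ Sa Sb _ gab).
Qed.

Lemma card_le_total (S T : Type) :
  [set: S] #<= [set: T] \/ [set: T] #<= [set: S].
Proof.
have [[] /= f] := @least_card bool true (fun b => if b then S else T).
  by have [g gI] := f false; left; apply/card_leTP; exists g.
by have [g gI] := f true; right; apply/card_leTP; exists g.
Qed.

(* Hilbert's hotel inside Y. *)
Lemma infinite_absorbs_point (T : Type) (Y : set T) : infinite_set Y ->
  exists s : option T -> T,
    [/\ bijective s, Y (s None), forall q, ~ Y q -> s (Some q) = q
      & forall q, Y q -> Y (s (Some q))].
Proof.
move=> /infiniteP/card_leTP[f fI fY].
pose s o := if o is Some q then
  if pselect (exists n, f n = q) is left e then f (projT1 (cid e)).+1 else q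
  else f 0%N.
have sf n : s (Some (f n)) = f n.+1.
  rewrite /s; case: pselect => [e|[]]; last by exists n.
  by case: cid => m /= /fI ->.
have sNf q : ~ (exists n, f n = q) -> s (Some q) = q.
  by rewrite /s; case: pselect.
have fP q : (exists n, q = f n) \/ ~ (exists n, f n = q).
  by have [[n <-]|] := pselect (exists n, f n = q); [left; exists n|right].
exists s; split=> [| |q Yq|q Yq]; last 3 first.
- exact: fY.
- by apply: sNf => -[n fq]; apply: Yq; rewrite -fq.
- by have [[n ->]|/sNf ->] := fP q; rewrite ?sf.
- apply: inj_surj_bij => [[q|] [r|]|y].
  + have [[n ->]|qN] := fP q; have [[m ->]|rN] := fP r; rewrite ?sf ?sNf //.
    * by move/fI => [->].
    * by move=> e; case: rN; exists n.+1.
    * by move=> e; case: qN; exists m.+1.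
    * by move=> ->.
  + have [[n ->]|qN] := fP q; rewrite ?sf ?sNf //; first by move/fI.
    by move=> e; case: qN; exists 0%N.
  + have [[n ->]|qN] := fP r; rewrite ?sf ?sNf //; first by move/fI.
    by move=> e; case: qN; exists 0%N.
  + by [].
  + have [[[|n] ->]|qN] := fP y; first by exists None.
      by exists (Some (f n)).
    by exists (Some y); rewrite sNf.
Qed.

(* For R with at least two elements, these are the non-principal ultrafilters
   that are closed under intersections of at most |R| sets. *)
Definition concentrating_filter (R P : Type) (U : set_system P) : Prop :=
  [/\ ProperFilter U, forall x, ~ U [set x]
    & forall a : P -> R, exists v, U (a @^-1` [set v])].

(** * From concentrating filters to measures *)

Section concentrating.
Context (R P : Type) (r0 r1 : R) (r01 : r0 <> r1).
Context (U : set_system P) (hU : concentrating_filter R U).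

#[local] Instance concentrating_proper : ProperFilter U.
Proof. by case: hU. Qed.

Let UI X Y : U X -> U Y -> U (X `&` Y).
Proof. exact: filterI. Qed.

Let Uex X : U X -> X !=set0.
Proof. exact: filter_ex. Qed.

(** The function equal to [r1] on X and [r0] elsewhere is constant on a member of U. That member
    lies inside X or inside its complement, according to the constant. *)
Lemma concentrating_ultra (X : set P) : ~ U X -> U (~` X).
Proof.
move=> UX; have [_ _ /(_ (fun y => if `[< X y >] then r1 else r0))[v Uv]] := hU.
have [v1|v1] := pselect (v = r1).
  case: UX; apply: filterS Uv => y /=; rewrite v1.
  by case: asboolP => // _ /r01.
apply: filterS Uv => y /= + Xy; rewrite (asboolT Xy) => rv.
exact: v1.
Qed.

(** Complements of points belong to U, hence so do complements of finite sets, and a finite member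
    would meet its own complement. *)
Lemma concentrating_infinite (Y : set P) : U Y -> infinite_set Y.
Proof.
move=> UY Yfin.
have /finite_seqP[s sY] : finite_set (Y : set {classic P}) by [].
have Us (t : seq {classic P}) : U [set y | y \notin t].
  elim: t => [|x t IH]; first by apply: filterS (@filterT _ U _) => y _.
  have [_ /(_ x)/concentrating_ultra Ux _] := hU.
  apply: filterS (UI Ux IH) => y [/= yx yt].
  by rewrite inE negb_or yt andbT; apply/eqP.
have /Uex[y [Yy]] := UI UY (Us s).
by rewrite /= => /negP; apply; move: Yy; rewrite sY.
Qed.

(** Label each point of the union by its piece, through an injection of I into R. The label is
    constant on a member of U, which therefore meets the union within a single piece. *)
Lemma concentrating_bigcup (I : Type) (F : I -> set P) :
  [set: I] #<= [set: R] -> trivIset [set: I] F ->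
  U (\bigcup_i F i) -> exists i, U (F i).
Proof.
move=> /card_leTP[c cI _] Ftriv UF0.
pose a y :=
  if pselect (exists i, F i y) is left e then c (projT1 (cid e)) else r0.
have [_ _ /(_ a)[v Uv]] := hU.
have UvF := UI Uv UF0.
have /Uex[y [ay [i _ Fiy]]] := UvF.
have aE z j : F j z -> a z = c j.
  rewrite /a => Fjz; case: pselect => [e|[]]; last by exists j.
  case: cid => k /= Fkz; congr c.
  by apply: Ftriv => //; exists z.
exists i; apply: filterS UvF => z [az [j _ Fjz]].
have -> // : i = j.
by apply: cI; rewrite -(aE _ _ Fiy) -(aE _ _ Fjz) ay az.
Qed.

Lemma concentrating_carries_measure : carries_measure R P.
Proof.
exists (fun X => nat_of_bool `[< U X >]); split.
- by move=> X; case: asboolP; [right|left].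
- by rewrite asboolT //; exact: filterT.
- by move=> x; rewrite asboolF //; case: hU.
move=> I F IR Ftriv.
(* At most one of the disjoint sets lies in U, so the sum has at most one nonzero term. *)
have [[i UFi]|noF] := pselect (exists i, U (F i)); last first.
  have F0 i : nat_of_bool `[< U (F i) >] = 0%N.
    by rewrite asboolF // => UFi; apply: noF; exists i.
  split.
    by rewrite (_ : [set _ | _] = set0) // -subset0 => i /=; rewrite F0.
  rewrite fsbig1 // asboolF // => /(concentrating_bigcup IR Ftriv).
  exact: noF.
have Fj j : j <> i -> nat_of_bool `[< U (F j) >] = 0%N.
  move=> ji; rewrite asboolF // => UFj.
  have /Uex[y [Fjy Fiy]] := UI UFj UFi.
  by apply: ji; apply: Ftriv => //; exists y.
split.
  apply: (sub_finite_set _ (finite_set1 i)) => j /= Uj.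
  by apply: contrapT => /Fj.
rewrite (fsbigE [:: i]) //=; last first.
  by move=> j _; rewrite inE => /eqP /Fj.
rewrite big_cons big_nil in_setT addn0 !asboolT //.
by apply: filterS UFi => y Fy; exists i.
Qed.

End concentrating.

(** * From measures to concentrating filters *)

(** The measure is pushed forward along the injection, under which a point has at most one
    preimage. *)
Lemma carries_measure_le (R K L : Type) :
  [set: K] #<= [set: L] -> carries_measure R K -> carries_measure R L.
Proof.
move=> /card_leTP[f fI _] [mu [mu01 muT mu1 muD]].
have mu_sub1 X : (forall x y, X x -> X y -> x = y) -> mu X = 0%N.
  move=> X1; have [[x Xx]|/forallNP X0] := pselect (exists x, X x).
    rewrite (_ : X = [set x]) //.
    by apply/seteqP; split=> [y /X1|y ->//]; exact.
  (* The preimage may be empty; additivity over the empty family makes the empty set null. *)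
  have [] := muD void (fun _ => set0).
  - by apply/card_leTP; exists (fun i : void => match i with end) => [[]|[]].
  - by case.
  rewrite fsbig1; last by case.
  rewrite (_ : X = set0); last by rewrite -subset0 => x /X0.
  by rewrite bigcup0.
exists (fun X => mu (f @^-1` X)); split => //.
  by move=> x; apply: mu_sub1 => y z /= <- /fI.
move=> I F IR Ftriv; rewrite preimage_bigcup; apply: muD => //.
by move=> i j _ _ [y [Fi Fj]]; apply: Ftriv => //; exists (f y).
Qed.

Section measure.
Context (R : choiceType) (P : Type) (r0 r1 : R) (r01 : r0 <> r1).
Context (mu : set P -> nat) (hmu : nontrivial_01_measure R mu).

Let muU (X Y : set P) : X `&` Y = set0 -> mu (X `|` Y) = (mu X + mu Y)%N.
Proof.
move=> XY0; have [_ _ _ /(_ bool (fun b => if b then X else Y))[]] := hmu.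
- apply/card_leTP; exists (fun b : bool => if b then r1 else r0) => //.
  by move=> [] [] // e; case: r01.
- move=> [] [] _ _ // [y [Xy Yy]];
  by have : (X `&` Y) y by []; rewrite XY0.
move=> _; rewrite (fsbigE [:: true; false]) //=; last by case.
rewrite !big_cons big_nil !in_setT addn0 => <-.
congr mu; apply/seteqP; split=> [y [Xy|Yy]|y [[] _]];
  [by exists true|by exists false|by left|by right].
Qed.

Lemma measure_concentrating : concentrating_filter R [set X | mu X = 1%N].
Proof.
have [mu01 muT mu1 muD] := hmu.
have muS X Y : X `<=` Y -> (mu X <= mu Y)%N.
  by move=> XY; rewrite -(setDUK XY) muU ?setDIK // leq_addr.
have mu0 : mu set0 = 0%N.
  by have := @muU set0 set0 (setI0 _); rewrite setU0; case: (mu01 set0) => ->.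
have mu_ge X : (0 < mu X)%N -> mu X = 1%N by case: (mu01 X) => ->.
split=> [|x /=|a]; last 2 first.
- by rewrite mu1.
(* The level sets of [a] partition P into pieces indexed by R; were they all null, P would be
   null. *)
- apply: contrapT => /forallNP noa.
  have [r s _ _ [y [/= <- <-]] //|_] :=
    muD R (fun r => a @^-1` [set r]) (card_lexx _).
  rewrite fsbig1 => [|r _]; last by have [|/noa] := mu01 (a @^-1` [set r]).
  rewrite (_ : \bigcup_i _ = setT) ?muT // -subTset => y _.
  by exists (a y).
split=> /=; first by rewrite mu0.
split=> //= [X Y X1 Y1|X Y XY X1]; last by apply: mu_ge; rewrite -X1 muS.
(* If the intersection were null, the disjoint sets X \ Y and Y would both have measure 1, and their
   union measure 2. *)
have [XY0|//] := mu01 (X `&` Y).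
have := mu01 (X `\` Y `|` Y); rewrite muU ?setDKI // Y1.
have -> : mu (X `\` Y) = 1%N; last by case.
rewrite -X1 -[in RHS](setUIDK X Y) muU ?XY0 //.
by rewrite -setIA setDIK setI0.
Qed.
End measure.

(** * Automorphisms of the full product are reindexings *)

(** Over an indecomposable ring these are exactly the idempotents of the product. *)
Definition ind (R : comPzRingType) (P : Type) (X : set P) : fullprod R P :=
  fun y => (`[< X y >] : nat)%:R.

Section ring.
Context (R : comPzRingType) (P : Type) (hR : indecomposable R).
Implicit Types (a b : fullprod R P) (X Y : set P).

Let R01 : (0 : R) <> 1. Proof. by case: hR. Qed.

Lemma indT (X : set P) y : X y -> ind R X y = 1.
Proof. by move=> Xy; rewrite /ind asboolT. Qed.

Lemma indF (X : set P) y : ~ X y -> ind R X y = 0.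
Proof. by move=> Xy; rewrite /ind asboolF. Qed.

Lemma ind01 X y : ind R X y = 0 \/ ind R X y = 1.
Proof. by rewrite /ind; case: asboolP; [right|left]. Qed.

Lemma ind_neq0 X y : ind R X y <> 0 -> X y.
Proof. by move=> Xy; apply: contrapT => /indF. Qed.

Lemma ind_idem X : ind R X * ind R X = ind R X.
Proof.
apply/funext => y; change (ind R X y * ind R X y = ind R X y).
by case: (ind01 X y) => ->; rewrite ?mulr0 ?mulr1.
Qed.

Lemma linear_coord (phi : fullprod R P -> fullprod R P) k a b x : linear phi ->
  phi (k *: a + b) x = k * phi a x + phi b x.
Proof. by move=> ->. Qed.

Lemma Aut_comp (s : P -> P) : bijective s ->
  Aut (fun a : fullprod R P => a \o s).
Proof.
move=> [t st ts]; split => //.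
exists (fun a : fullprod R P => a \o t) => a; apply/funext => x /=.
  by rewrite ts.
by rewrite st.
Qed.

Lemma AutP (phi : fullprod R P -> fullprod R P) :
  Aut phi <-> exists2 s : P -> P, bijective s & forall a, phi a = a \o s.
Proof.
split=> [[lin [phi1 phiM] [psi phiK psiK]]|[s s_bij phiE]]; last first.
  rewrite (_ : phi = fun a => a \o s); first exact: Aut_comp.
  exact/funext.
have phi0 : phi 0 = 0.
  have := lin (-1) 0 0; rewrite scaler0 addr0 => e.
  by rewrite e scaleN1r addNr.
have phi_eq0 a : phi a = 0 -> a = 0.
  by move=> pa; rewrite -(phiK a) pa -[X in psi X]phi0 phiK.
have phi_idem a : a * a = a -> forall x, phi a x = 0 \/ phi a x = 1.
  move=> aa x; case: hR => _; apply.
  by rewrite -[in RHS]aa phiM.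
(* The preimage [u] of the indicator of x is a nonzero idempotent, so it equals 1 at some y. Then
   the indicator of y is a multiple of [u], and its image is a nonzero idempotent supported at x. *)
have point x : exists y, phi (ind R [set y]) = ind R [set x].
  pose u := psi (ind R [set x]).
  have uu : u * u = u.
    apply: (can_inj phiK); rewrite phiM psiK.
    exact: ind_idem.
  have u01 y : u y = 0 \/ u y = 1.
    by case: hR => _; apply; rewrite -[in RHS]uu.
  have [y uy] : exists y, u y = 1.
    apply: contrapT => /forallNP u1.
    have u0 : u = 0 by apply/funext => y; case: (u01 y) => // /u1.
    have := psiK (ind R [set x]); rewrite -/u u0 phi0 => /(congr1 (@^~ x)).
    by rewrite indT.
  exists y; set e := ind R [set y].
  have eu : e * u = e.
    apply/funext => z; change (e z * u z = e z); rewrite /e.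
    have [->|zy] := pselect (z = y); first by rewrite uy mulr1.
    by rewrite indF // mul0r.
  have pe : phi e = phi e * ind R [set x].
    by rewrite -(psiK (ind R [set x])) -/u -phiM eu.
  have pez z : phi e z = phi e z * ind R [set x] z by rewrite [in LHS]pe.
  have pe0 z : z <> x -> phi e z = 0 by move=> zx; rewrite pez indF // mulr0.
  apply/funext => z; have [->|zx] := pselect (z = x); last first.
    by rewrite pe0 // indF.
  rewrite (indT (erefl : [set x] x)).
  have [pex|//] := phi_idem e (ind_idem _) x.
  have /phi_eq0/(congr1 (@^~ y)) : phi e = 0.
    apply/funext => w; have [->|/pe0 //] := pselect (w = x).
    exact: pex.
  by rewrite /e indT // => /esym/R01.
have /choice[s phis] := point.
(* Multiplying [a] by the indicator of [s x] isolates the coordinate [a (s x)]; [phi] carries that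
   indicator to the one of x. *)
have phiE a : phi a = a \o s.
  apply/funext => x; set e := ind R [set s x].
  have ea : e * a = a (s x) *: e.
    apply/funext => y; change (e y * a y = a (s x) * e y); rewrite /e.
    have [->|ysx] := pselect (y = s x); first by rewrite mulrC.
    by rewrite indF // mulr0 mul0r.
  have := congr1 (fun b => phi b x) ea; rewrite phiM /=.
  have -> : phi (a (s x) *: e) x = a (s x) * phi e x.
    by rewrite -[X in phi X]addr0 linear_coord // phi0 addr0.
  change (phi e x * phi a x = a (s x) * phi e x -> phi a x = a (s x)).
  by rewrite /e phis indT // mul1r mulr1.
exists s => //; apply: inj_surj_bij => [x x' sx|y].
  apply: contrapT => xx'.
  have : ind R [set x] x' = ind R [set x'] x' by rewrite -phis sx phis.
  rewrite (indT (erefl : [set x'] x')) indF // => e.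
  exact/xx'/esym.
apply: contrapT => /forallNP ys.
have /phi_eq0/(congr1 (@^~ y)) : phi (ind R [set y]) = 0.
  by rewrite phiE; apply/funext => x; exact: (indF (ys x)).
by rewrite indT // => /esym/R01.
Qed.

Lemma Aut_LAut (phi : fullprod R P -> fullprod R P) : Aut phi -> LAut phi.
Proof. by move=> phiA; split=> [|a]; [case: phiA|exists phi]. Qed.

(** * Local automorphisms that are automorphisms *)

Section local.
Context (eta : fullprod R P -> fullprod R P) (hEta : LAut eta).

Let lin : linear eta. Proof. by case: hEta. Qed.

Let local a : exists2 s : P -> P, bijective s & eta a = a \o s.
Proof.
have [_ /(_ (fun _ => a))[phi /AutP[s sbij phiE] /(_ ord0) e]] := hEta.
by exists s => //; rewrite e.
Qed.

Let eta0 : eta 0 = 0. Proof. by have [s _ ->] := local 0. Qed.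
Let eta1 : eta 1 = 1. Proof. by have [s _ ->] := local 1. Qed.

Let eta_scale k a x : eta (k *: a) x = k * eta a x.
Proof. by rewrite -[k *: a]addr0 linear_coord // eta0 addr0. Qed.

Let eta_eq0 a : eta a = 0 -> a = 0.
Proof.
have [s [t st ts] ->] := local a => as0; apply/funext => y.
by have := congr1 (@^~ (t y)) as0; rewrite /= ts.
Qed.

Let eta_ind01 X x : eta (ind R X) x = 0 \/ eta (ind R X) x = 1.
Proof. by have [s _ ->] := local (ind R X); exact: ind01. Qed.

(* Otherwise eta would map a - v 1 + 1_X, with v := eta a x and X the level
   set, to an element vanishing at x, although it has no zero. *)
Lemma LAut_level a x : eta (ind R (a @^-1` [set eta a x])) x = 1.
Proof.
set v := eta a x; set X := _ @^-1` _.
have [X0|//] := eta_ind01 X x.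
pose b : fullprod R P := (- v) *: (1 : fullprod R P) + (1 *: a + ind R X).
have : eta b x = 0.
  by rewrite !linear_coord // X0 eta1 addr0 mul1r mulr1 addNr.
have [s _ ->] := local b; rewrite /=; set y := s x.
change (- v * 1 + (1 * a y + ind R X y) = 0 -> eta (ind R X) x = 1).
rewrite mulr1 mul1r; have [Xy|Xy] := pselect (X y).
  rewrite indT // (_ : a y = v) // addrA addNr add0r.
  by move/esym/R01.
by rewrite indF // addr0 addrC => /eqP; rewrite subr_eq0 => /eqP.
Qed.

(** A point missed by the reindexing would have its indicator killed by [eta]. Two points with the
    same image y would both carry the value 1 in the image of the indicator of y, which is again the
    indicator of a single point. *)
Lemma LAut_Aut (hpt : forall x, exists y, forall a, eta a x = a y) : Aut eta.
Proof.
have /choice[s etaE] := hpt.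
apply/AutP; exists s; last by move=> a; apply/funext => x; exact: etaE.
apply: inj_surj_bij => [x x' sx|y]; last first.
  apply: contrapT => /forallNP ys.
  have /eta_eq0/(congr1 (@^~ y)) : eta (ind R [set y]) = 0.
    by apply/funext => x; rewrite etaE; exact: (indF (ys x)).
  by rewrite indT // => /esym/R01.
have [t [u tu ut] e] := local (ind R [set s x]).
have t1 z : s z = s x -> t z = s x.
  move=> sz; apply: (@ind_neq0 [set s x]); have /= <- := congr1 (@^~ z) e.
  by rewrite etaE sz indT // => /esym/R01.
by rewrite -(tu x) -(tu x') !t1.
Qed.

(** By finite linearity, coordinate x of [eta a] depends only on the images of the indicators [e y].
    Exactly one of these is nonzero at x: two would both equal the indicator of x, so [eta] would
    kill their difference. *)
Lemma LAut_finite : finite_set [set: P] -> Aut eta.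
Proof.
move=> Pfin; have /finite_seqP[s sP] : finite_set [set: {classic P}] by [].
pose e (y : P) := ind R [set y].
(* Induction on a list outside which the function vanishes, clearing one coordinate at a time. *)
have eta_null x b : (forall y, eta (b y *: e y) x = 0) -> eta b x = 0.
  move=> b0.
  suff H (r : seq {classic P}) c : (forall y, y \notin r -> c y = 0) ->
      (forall y, eta (c y *: e y) x = 0) -> eta c x = 0.
    apply: (H s) => // y; have : [set: {classic P}] y by [].
    by rewrite sP /= => ->.
  elim: r c => [|z r IH] c cr c0.
    by rewrite (_ : c = 0) ?eta0 //; apply/funext => y; exact: cr.
  pose c' : fullprod R P := (- c z) *: e z + c.
  have c'z : c' z = 0.
    by change (- c z * ind R [set z] z + c z = 0); rewrite indT // mulr1 addNr.
  have c'E y : y <> z -> c' y = c y.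
    move=> yz; change (- c z * ind R [set z] y + c y = c y).
    by rewrite indF // mulr0 add0r.
  have <- : eta c' x = eta c x.
    by rewrite linear_coord // mulNr -eta_scale c0 oppr0 add0r.
  apply: IH => y.
    have [->|yz] := pselect (y = z); first by rewrite c'z.
    move=> yr; rewrite c'E // cr // inE negb_or yr andbT.
    exact/eqP.
  have [->|yz] := pselect (y = z); first by rewrite c'z scale0r eta0.
  by rewrite c'E.
apply: LAut_Aut => x.
have [y ey] : exists y, eta (e y) x <> 0.
  apply: contrapT => /forallNP ex0.
  have : eta 1 x = 0.
    by apply: eta_null => y; rewrite eta_scale (contrapT (ex0 y)) mulr0.
  by rewrite eta1 => /esym/R01.
have ind_of w z : eta (e w) z <> 0 -> eta (e w) = ind R [set z].
  have [t [u tu ut] ->] := local (e w) => /ind_neq0 /= tz.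
  apply/funext => z' /=; have [->|zz'] := pselect (z' = z).
    by rewrite /e !indT.
  rewrite /e [RHS](indF zz') indF // => tz'; apply: zz'.
  by rewrite -(tu z') tz' -tz tu.
(* [b] is [a] with its coordinate at y removed. *)
exists y => a; pose b : fullprod R P := (- a y) *: e y + a.
have ex1 : eta (e y) x = 1 by rewrite (ind_of y x) // indT.
suff : eta b x = 0.
  rewrite linear_coord // ex1 mulr1 addrC => /eqP.
  by rewrite subr_eq0 => /eqP.
apply: eta_null => z; have [->|zy] := pselect (z = y).
  have -> : b y = 0.
    by change (- a y * ind R [set y] y + a y = 0); rewrite indT // mulr1 addNr.
  by rewrite scale0r eta0.
rewrite eta_scale; apply: contrapT => bz.
have ez : eta (e z) x <> 0 by move=> e0; apply: bz; rewrite e0 mulr0.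
have /eta_eq0 : eta ((-1) *: e z + e y) = 0.
  by rewrite lin scaleN1r (ind_of z x ez) (ind_of y x ey) addNr.
move/(congr1 (@^~ y)).
change (-1 * ind R [set z] y + ind R [set y] y = 0 -> False).
by rewrite indF ?indT // ?mulr0 ?add0r; [move/esym/R01|move=> yz; apply: zy].
Qed.

Lemma LAut_infinite : infinite_set [set: R] -> ~ carries_measure R P -> Aut eta.
Proof.
move=> Rinf nomu.
(* This choice of [c] keeps 1 + c apart from 0, 1 and c, and 1 apart from 0, c and 1 + c, so values
   of [c *: ind R Y + ind R X] reveal membership in X and Y. *)
have [c [c0 c1 cN1]] : exists c : R, [/\ c <> 0, c <> 1 & 1 + c <> 0].
  have : infinite_set ([set: R] `\` [set 0; 1; -1]).
    by apply: infinite_setD => //; exact: finite_set3.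
  move/infinite_setN0 => [c [_ cN]]; exists c; split=> e; apply: cN.
  - by left; left.
  - by left; right.
  - by right; apply/eqP; rewrite -addr_eq0 addrC e.
apply: LAut_Aut => x; pose U := [set X | eta (ind R X) x = 1].
have Ulevel a : U (a @^-1` [set eta a x]) by exact: LAut_level.
have N0 : ~ U set0.
  rewrite /U /= (_ : ind R set0 = 0); first by rewrite eta0; exact: R01.
  by apply/funext => y; exact: indF.
have UI X Y : U X -> U Y -> U (X `&` Y).
  (* The level set of this combination at c + 1 is exactly the intersection of X and Y. *)
  move=> UX UY; have := Ulevel (c *: ind R Y + ind R X).
  rewrite linear_coord // UX UY mulr1; congr U; apply/seteqP.
  split=> y /=;
    change ((c *: ind R Y + ind R X) y) with (c * ind R Y y + ind R X y).
    have [Yy|/indF ->] := pselect (Y y);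
      have [Xy|/indF ->] := pselect (X y) => //.
    - by rewrite (indT Yy) mulr1 addr0 => e; case: R01; apply: (addrI c);
        rewrite addr0.
    - rewrite (indT Xy) mulr0 add0r => /esym e; case: c0.
      by apply: (addIr 1); rewrite add0r.
    - by rewrite mulr0 addr0 addrC => /esym/cN1.
  by move=> [Xy Yy]; rewrite !indT // mulr1.
have US X Y : X `<=` Y -> U X -> U Y.
  (* If Y were not in U, the combination would have image 1 at x, yet it takes only the values 0, c
     and 1 + c because X lies in Y. *)
  move=> XY UX; have [Y0|//] := eta_ind01 Y x.
  have := Ulevel (c *: ind R Y + ind R X).
  rewrite linear_coord // UX Y0 mulr0 add0r.
  rewrite (_ : _ @^-1` _ = set0) //; rewrite -subset0 => y /=.
  change ((c *: ind R Y + ind R X) y) with (c * ind R Y y + ind R X y).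
  have [Xy|/indF ->] := pselect (X y).
    rewrite (indT Xy) (indT (XY _ Xy)) mulr1 => e; case: c0.
    by apply: (addIr 1); rewrite add0r.
  by have [->|->] := ind01 Y y; rewrite ?mulr0 ?mulr1 addr0 => // /R01.
have [y Uy] : exists y, U [set y].
  apply: contrapT => /forallNP Usingle; apply: nomu.
  apply: (@concentrating_carries_measure _ _ 0 U).
  split=> //; last by move=> a; exists (eta a x).
  split=> //; split => //.
  rewrite /U /= (_ : ind R setT = 1) ?eta1 //.
  by apply/funext => y; exact: indT.
(* The singleton of y and the level set both lie in U, so they meet, and only at y. *)
exists y => a; have := UI _ _ Uy (Ulevel a).
have [//|ay] := pselect (a y = eta a x).
rewrite (_ : _ `&` _ = set0) //; rewrite -subset0 => z [/= ->].
exact: ay.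
Qed.

End local.
End ring.

(** * A non-surjective local automorphism built from limits along a filter *)

Lemma concentrating_local (R : comPzRingType) (P : Type) (r01 : (0 : R) <> 1)
    (U : set_system P) : concentrating_filter R U ->
  exists eta : fullprod R P -> fullprod R P,
    [/\ linear eta, eta 1 = 1, forall n : nat, nLAut n eta
      & ~ (forall b, exists a, eta a = b)].
Proof.
move=> hU; have [UF _ Uconst] := hU.
have Uinf Y : U Y -> infinite_set Y by exact: (concentrating_infinite r01 hU).
pose lam (a : fullprod R P) : R := projT1 (cid (Uconst a)).
have lamU a : U (a @^-1` [set lam a]) by exact: (projT2 (cid (Uconst a))).
have lamE a v : U (a @^-1` [set v]) -> lam a = v.
  move=> Uv; have /filter_ex[y [/= <- <-]] // :
    U (a @^-1` [set lam a] `&` a @^-1` [set v]).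
  exact: filterI.
have lam_cst v : lam (fun=> v) = v.
  by apply: lamE; apply: filterS (@filterT _ U _) => y _.
have lam_lin k a b : lam (k *: a + b) = k * lam a + lam b.
  apply: lamE.
  by apply: filterS (@filterI _ U _ _ _ (lamU a) (lamU b)) => y [/= <- <-].
pose ext (a : fullprod R P) o := if o is Some q then a q else lam a.
have [s [[g sg gs] _ _ _]] := infinite_absorbs_point (Uinf _ (@filterT _ U _)).
have eta_lin : linear ((fun a p => ext a (g p)) : fullprod R P -> fullprod R P).
  move=> k a b; apply/funext => p.
  change (ext (k *: a + b) (g p) = k * ext a (g p) + ext b (g p)).
  by case: (g p) => [q|] /=; [|exact: lam_lin].
exists (fun a p => ext a (g p)); split=> // [|n|].
- by apply/funext => p; case: (g p) => [q|] //=; exact: lam_cst.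
- split=> // a.
  (* On [Y] each of the finitely many functions equals its limit. The bijection [t] sends the extra
     point into [Y] and moves points only within [Y], so it reproduces the extended functions. *)
  pose Y := [set y | forall i, a i y = lam (a i)].
  have UY : U Y.
    exact: (@filter_forall _ _ (fun i => a i @^-1` [set lam (a i)]) U _
      (fun i => lamU (a i))).
  have [t [tbij tN tYN tY]] := infinite_absorbs_point (Uinf _ UY).
  exists (fun b => b \o (t \o g)).
    by apply: Aut_comp; apply: bij_comp => //; exists s.
  move=> i; apply/funext => p /=; case: (g p) => [q|] /=.
    have [Yq|Yq] := pselect (Y q); first by rewrite (Yq i) (tY _ Yq i).
    by rewrite tYN.
  by rewrite (tN i).
(* A preimage of this indicator would vanish on all of P, so its limit, which is the coordinate at
   [s None], would be 0 instead of 1. *)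
move=> /(_ (ind R [set s None]))[a aE].
have aN p : ext a (g p) = ind R [set s None] p by rewrite -aE.
have a0 : a = fun=> 0.
  apply/funext => q; have := aN (s (Some q)); rewrite sg /= => ->.
  by rewrite indF // => /(can_inj sg).
by have := aN (s None); rewrite sg /= a0 lam_cst indT // => /r01.
Qed.

(** * Comparing the cardinality of P with mu_R *)

(** Any ultrafilter containing the cofinite sets works: the finitely many level sets of a function
    cover P, so one of them is a member. *)
Lemma infinite_concentrating (R : choiceType) (P : Type) :
  finite_set [set: R] -> infinite_set [set: P] ->
  exists U : set_system P, concentrating_filter R U.
Proof.
move=> Rfin Pinf.
have [U [UU FU]] := ultraFilterLemma (frechet_properfilter Pinf).
have UF : ProperFilter U by exact: ultra_proper.
exists U; split=> // [x Ux|a].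
  have /filter_ex[y [/=]] // : U ([set x] `&` ~` [set x]).
  apply: filterI => //; apply: FU.
  by rewrite /frechet_filter /= setCK; exact: finite_set1.
apply: contrapT => /forallNP noa.
have /finite_fsetP[D DE] := Rfin.
have : U (\bigcap_(v in [set: R]) ~` (a @^-1` [set v])).
  rewrite DE; apply: filter_bigI => v _.
  by have [/noa|] := in_ultra_setVsetC (a @^-1` [set v]) UU.
move=> /filter_ex[y /(_ (a y))]; by apply.
Qed.

Lemma ge_mu_concentrating (R : comPzRingType) (P : Type) (r01 : (0 : R) <> 1) :
  ge_mu R P -> exists U : set_system P, concentrating_filter R U.
Proof.
move=> [K [Kfin Kinf] KP]; have [Rfin|Rinf] := pselect (finite_set [set: R]).
  apply: infinite_concentrating => //; apply/infiniteP.
  by apply: card_le_trans KP; have := Kfin Rfin; rewrite card_eq_le => /andP[].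
have [Kmu _] := Kinf Rinf.
have [mu hmu] := carries_measure_le KP Kmu.
by exists [set X | mu X = 1%N]; exact: (measure_concentrating r01).
Qed.

(** Among all types carrying a measure one has least cardinality; it realizes mu_R and injects into
    P. *)
Lemma infinite_ge_mu (R P : Type) :
  infinite_set [set: R] -> carries_measure R P -> ge_mu R P.
Proof.
move=> Rinf Pmu.
have [[K Kmu] Kle] := @least_card {L : Type & carries_measure R L}
  (existT _ P Pmu) (fun L => projT1 L).
have Kmin L : carries_measure R L -> [set: K] #<= [set: L].
  by move=> Lmu; have [f fI] := Kle (existT _ L Lmu); apply/card_leTP; exists f.
by exists K; [split|exact: Kmin].
Qed.

Lemma finite_ge_mu (R P : Type) :
  finite_set [set: R] -> infinite_set [set: P] -> ge_mu R P.
Proof. by move=> Rfin /infiniteP Pinf; exists nat. Qed.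

Lemma lt_muN (R P : Type) : lt_mu R P <-> ~ ge_mu R P.
Proof.
split=> [lt [K Kmu KP]|nge K Kmu]; first by have [_] := lt K Kmu.
have nKP : ~ ([set: K] #<= [set: P]) by move=> KP; apply: nge; exists K.
by split=> //; have [|//] := card_le_total P K.
Qed.

Theorem theorem1p3 (R : comPzRingType) (P : Type) (hR : indecomposable R) :
  (@LAut R P = @Aut R P <-> lt_mu R P) /\
  (ge_mu R P ->
     exists eta : fullprod R P -> fullprod R P,
       [/\ linear eta,
           eta 1 = 1,
           forall n : nat, (0 < n)%N -> nLAut n eta,
           ~ (forall b, exists a, eta a = b)
         & ~ Aut eta]).
Proof.
have [r01 _] := hR.
have partb : ge_mu R P -> exists eta : fullprod R P -> fullprod R P,
    [/\ linear eta, eta 1 = 1, forall n : nat, (0 < n)%N -> nLAut n eta,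
        ~ (forall b, exists a, eta a = b) & ~ Aut eta].
  move=> /(ge_mu_concentrating r01)[U /(concentrating_local r01)].
  move=> [eta [lin eta1 etan etaS]]; exists eta; split=> //.
  by move=> [_ _ [h _ etah]]; apply: etaS => b; exists (h b).
split=> //; split=> [LA|/lt_muN nge].
  (* The case n = 1 of part (b) is a local automorphism that is not an automorphism. *)
  apply/lt_muN => /partb[eta [_ _ etan _]].
  by rewrite -LA; apply; exact: etan.
apply/seteqP; split=> [eta etaL|phi]; last exact: Aut_LAut.
have [Rfin|Rinf] := pselect (finite_set [set: R]).
  apply: (LAut_finite hR etaL); apply: contrapT => Pinf.
  exact/nge/finite_ge_mu.
by apply: (LAut_infinite hR etaL Rinf) => Pmu; apply/nge/infinite_ge_mu.
Qed.
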